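(* Let $S$ be a set of surreals, let $s = \sup^* S$ and $\alpha = \ell(s)$. Then for every surreal $z$: $u < z$ for all $u \in S$ if and only if $s \leq z_{\restriction \alpha}$.
   Context: A surreal is a function $s$ from some ordinal $\ell(s)$ (its length, possibly $0$) to $\{+,-\}$; for $\gamma \geq \ell(s)$, $s(\gamma)$ is called undefined. ''$s(\gamma)=t(\gamma)$'' means both undefined or both defined and equal. Order: for distinct $s,t$, with $\gamma$ least such that $s(\gamma)\neq t(\gamma)$, $s<t$ iff $s(\gamma)<t(\gamma)$ in the ordering $- < \text{undefined} < +$. For $\gamma \leq \ell(s)$, $s_{\restriction\gamma}$ is the surreal of length $\gamma$ agreeing with $s$ below $\gamma$; for $\gamma > \ell(s)$, $s_{\restriction\gamma}=s$; $s_{\restriction\leq\gamma} := s_{\restriction(\gamma+1)}$. For a surreal $u$ of length $\beta$, $u^\frown +$ is the surreal of length $\beta+1$ extending $u$ with value $+$ at $\beta$. Definition of $\sup^* S$ for a set $S$ of surreals: if $S$ has a maximum $u$, $\sup^* S = u^\frown +$. If $S$ has no maximum, $\sup^* S$ is the surreal $s$ such that, for each ordinal $\gamma$, $s(\gamma)$ is defined iff there is $u \in S$ with $u(\gamma)$ defined such that $u'_{\restriction\leq\gamma} = u_{\restriction\leq\gamma}$ for every $u' \in S$ with $u' \geq u$, and in that case $s(\gamma) = u(\gamma)$ (this is independent of the choice of $u$ and yields a surreal; if $S=\emptyset$ it is the empty sequence). *)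

(* Defs.v *)
From HB Require Import structures.
From mathcomp Require Import all_boot all_order.
From mathcomp Require Import boolp classical_sets.

Set Implicit Arguments.
Unset Strict Implicit.
Unset Printing Implicit Defensive.

Import Order.TTheory.
Local Open Scope order_scope.
Local Open Scope classical_set_scope.
Local Open Scope quotient_scope.

(* [small] is a fixed universe: its inhabitants play the role of sets.
   Ordinals and surreals live in a strictly larger universe and play the role
   of proper classes. *)
Definition small := Type.

(* A class is a set when it is the image of a function defined on a set. *)
Definition is_small (T : Type) (A : set T) : Prop :=
  exists (I : small) (f : I -> T), A = range f.

(* Ordinals. [Node I f] stands for the least ordinal strictly above all the
   [f i]; distinct trees may stand for the same ordinal, so ordinals are trees
   modulo the equivalence generated by the total preorder [tree_le]. The lemmas
   [ord_lt_wf], [ord_seg_small] and [ord_small_ub] below say that the resulting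
   total order is well-founded, that its proper initial segments are sets, and
   that every set of ordinals is strictly bounded; these characterise the class
   of ordinals up to a unique isomorphism. *)
Inductive tree : Type := Node (I : small) of (I -> tree).

Fixpoint tree_le (x y : tree) {struct x} : Prop :=
  let: Node X f := x in
  let: Node J g := y in
  forall i, exists j, tree_le (f i) (g j).

Lemma tree_le_refl x : tree_le x x.
Proof. by elim: x => I f IH /= i; exists i. Qed.

Lemma tree_le_trans y x z : tree_le x y -> tree_le y z -> tree_le x z.
Proof.
elim: x y z => I f IH [J g] [K h] /= xy yz i.
have [j fg] := xy i; have [k gh] := yz j.
by exists k; apply: IH fg gh.
Qed.

Lemma tree_le_total x y : tree_le x y \/ tree_le y x.
Proof.
elim: x y => I f IH [J g]; have [xy|/existsNP[i /forallNP fg]] :=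
  pselect (tree_le (Node f) (Node g)); [by left|right => j].
by exists i; case: (IH i (g j)) => // /(fg j).
Qed.

Lemma tree_ltP (I : small) (f : I -> tree) y :
  ~ tree_le (Node f) y <-> exists i, tree_le y (f i).
Proof.
split; last first.
  move=> [i yf] fy.
  suff: forall t (J : small) (g : J -> tree) j,
      tree_le t (g j) -> ~ tree_le (Node g) t.
    by move=> /(_ (f i) I f i (tree_le_refl _)); apply; apply: tree_le_trans yf.
  elim=> K h IH J g j le gt; have [k gh] := gt j.
  apply: (IH k K h k (tree_le_refl _)).
  exact: tree_le_trans gh.
suff: forall x y, ~ tree_le x y ->
    let: Node X f := x in exists i, tree_le y (f i).
  by move=> /(_ (Node f) y).
elim=> {}I {}f IH [J g] /existsNP[i /forallNP fg].
exists i; move: (IH i) fg; case: (f i) => K h {}IH fg j.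
exact: IH (fg j).
Qed.

Definition tree_eqv : rel tree :=
  fun x y => `[< tree_le x y /\ tree_le y x >].

Lemma tree_eqv_refl : reflexive tree_eqv.
Proof. by move=> x; apply/asboolP; split; apply: tree_le_refl. Qed.

Lemma tree_eqv_sym : symmetric tree_eqv.
Proof. by move=> x y; apply/asboolP/asboolP => -[]. Qed.

Lemma tree_eqv_trans : transitive tree_eqv.
Proof.
move=> y x z /asboolP[xy yx] /asboolP[yz zy]; apply/asboolP; split.
  exact: tree_le_trans yz.
exact: tree_le_trans yx.
Qed.

HB.instance Definition _ := gen_eqMixin tree.
HB.instance Definition _ := gen_choiceMixin tree.

Canonical tree_equiv := EquivRel tree_eqv tree_eqv_refl tree_eqv_sym
  tree_eqv_trans.

Definition ord := {eq_quot tree_eqv}.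
HB.instance Definition _ := Choice.on ord.

Definition ord_of_tree (t : tree) : ord := \pi_{eq_quot tree_eqv} t.
Definition tree_of_ord (a : ord) : tree := repr (a : {eq_quot tree_eqv}).

Lemma tree_of_ordK : cancel tree_of_ord ord_of_tree.
Proof. exact: reprK. Qed.

Lemma ord_of_treeK t :
  tree_le (tree_of_ord (ord_of_tree t)) t /\
  tree_le t (tree_of_ord (ord_of_tree t)).
Proof.
apply/asboolP; have /eqmodP := reprK (\pi_{eq_quot tree_eqv} t); exact.
Qed.

Definition ord_le : rel ord :=
  fun a b => `[< tree_le (tree_of_ord a) (tree_of_ord b) >].

Lemma ord_le_refl : reflexive ord_le.
Proof. by move=> a; apply/asboolP; apply: tree_le_refl. Qed.

Lemma ord_le_anti : antisymmetric ord_le.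
Proof.
move=> a b /andP[/asboolP ab /asboolP ba].
rewrite -[a]tree_of_ordK -[b]tree_of_ordK; apply/eqmodP.
exact/asboolP.
Qed.

Lemma ord_le_trans : transitive ord_le.
Proof.
move=> b a c /asboolP ab /asboolP bc; apply/asboolP.
exact: tree_le_trans bc.
Qed.

HB.instance Definition _ := Order.Le_isPOrder.Build (Order.Disp tt tt) ord
  ord_le_refl ord_le_anti ord_le_trans.

Lemma ord_le_total : total (<=%O : rel ord).
Proof.
move=> a b; case: (tree_le_total (tree_of_ord a) (tree_of_ord b)) => h.
  by apply/orP; left; apply/asboolP.
by apply/orP; right; apply/asboolP.
Qed.

HB.instance Definition _ := Order.POrder_isTotal.Build _ ord ord_le_total.

Lemma ord_leP (a b : ord) :
  reflect (tree_le (tree_of_ord a) (tree_of_ord b)) (a <= b).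
Proof. exact: asboolP. Qed.

Lemma ord_lt_node (a : ord) (I : small) (f : I -> tree) :
  a < ord_of_tree (Node f) <-> exists i, a <= ord_of_tree (f i).
Proof.
have [h1 h2] := ord_of_treeK (Node f).
rewrite ltNge; split.
  move=> /negP na.
  have /tree_ltP[i ai] : ~ tree_le (Node f) (tree_of_ord a).
    by move=> h; apply: na; apply/ord_leP; apply: tree_le_trans h.
  by exists i; apply/ord_leP; apply: tree_le_trans ai (ord_of_treeK _).2.
move=> [i /ord_leP ai]; apply/negP => /ord_leP fa.
have /tree_ltP : exists i, tree_le (tree_of_ord a) (f i).
  by exists i; apply: tree_le_trans ai (ord_of_treeK _).1.
by apply; apply: tree_le_trans fa.
Qed.

Lemma ord_lt_wf : well_founded (fun a b : ord => a < b).
Proof.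
suff acc t (a : ord) : a <= ord_of_tree t -> Acc (fun a b : ord => a < b) a.
  by move=> a; apply: (acc (tree_of_ord a)); rewrite tree_of_ordK.
elim: t a => I f IH a af; constructor => b ba.
have /ord_lt_node[i bi] := lt_le_trans ba af.
exact: IH bi.
Qed.

Lemma ord_seg_small (a : ord) : is_small [set b : ord | b < a].
Proof.
rewrite -[a]tree_of_ordK; elim: (tree_of_ord a) => I f IH.
have [J JP] := choice IH.
pose g i := sval (cid (JP i)).
have gP i : [set b : ord | b < ord_of_tree (f i)] = range (g i).
  exact: svalP (cid (JP i)).
exists {i : I & option (J i)}.
exists (fun p => if projT2 p is Some j then g _ j
                 else ord_of_tree (f (projT1 p))).
apply/seteqP; split => b /=.
  move=> /ord_lt_node[i]; rewrite le_eqVlt => /orP[/eqP ->|bi].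
    by exists (existT _ i None).
  have : [set b : ord | b < ord_of_tree (f i)] b by [].
  by rewrite gP => -[j _ <-]; exists (existT _ i (Some j)).
move=> [[i [j|]] _ /= <-]; apply/ord_lt_node; exists i => //.
have : range (g i) (g i j) by exists j.
by rewrite -gP => /ltW.
Qed.

Lemma ord_small_ub (A : set ord) :
  is_small A -> exists b, forall a, A a -> a < b.
Proof.
move=> [I [f ->]].
exists (ord_of_tree (Node (fun i => tree_of_ord (f i)))) => _ [i _ <-].
by apply/ord_lt_node; exists i; rewrite tree_of_ordK.
Qed.

Lemma ord_least (P : set ord) :
  (exists a, P a) -> exists2 a, P a & forall b : ord, b < a -> ~ P b.
Proof.
move=> [a]; elim/(well_founded_ind ord_lt_wf): a => a IH Pa.
have [[b [ba Pb]]|/forallNP n] := pselect (exists b, b < a /\ P b).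
  exact: IH Pb.
by exists a => // b ba Pb; apply: (n b).
Qed.

Definition ord_succ (a : ord) : ord :=
  ord_of_tree (Node (fun _ : unit => tree_of_ord a)).

Lemma ord_lt_succ (a b : ord) : (b < ord_succ a) = (b <= a).
Proof.
apply/idP/idP.
  by move=> /ord_lt_node[_]; rewrite tree_of_ordK.
by move=> ba; apply/ord_lt_node; exists tt; rewrite tree_of_ordK.
Qed.

Inductive sign := Plus | Minus.

(* [s a = None] means that the surreal [s] is undefined at [a]. *)
Record surreal := Surreal {
  len : ord;
  sgn :> ord -> option sign;
  sgnP : forall a, sgn a <> None <-> a < len }.

(* Minus < undefined < Plus *)
Definition sign_rank (x : option sign) : nat :=
  match x with Some Minus => 0 | None => 1 | Some Plus => 2 end.

Lemma sign_rank_inj : injective sign_rank.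
Proof. by case=> [[]|] [[]|]. Qed.

Lemma surreal_ext (s t : surreal) : (forall a, s a = t a) -> s = t.
Proof.
case: s t => [l f fP] [l' f' fP'] /= /funext ff'; subst f'.
have ll' : l = l'.
  apply/eqP; rewrite eq_le; apply/andP; split; rewrite leNgt; apply/negP.
    by move=> /fP /fP'; rewrite ltxx.
  by move=> /fP' /fP; rewrite ltxx.
by subst l'; congr Surreal; apply: Prop_irrelevance.
Qed.

Definition surreal_lt (s t : surreal) : bool :=
  `[< exists c : ord, (forall a, a < c -> s a = t a) /\
                      (sign_rank (s c) < sign_rank (t c))%N >].

Lemma surreal_lt_irr : irreflexive surreal_lt.
Proof. by move=> s; apply/asboolP => -[c [_]]; rewrite ltnn. Qed.

Lemma surreal_lt_trans : transitive surreal_lt.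
Proof.
move=> t s u /asboolP[c [stc ltc]] /asboolP[d [tud ltd]]; apply/asboolP.
case: (ltgtP c d) => cd.
- exists c; split; last by rewrite -tud.
  by move=> a ac; rewrite stc // tud // (lt_trans ac).
- exists d; split; last by rewrite stc.
  by move=> a ad; rewrite stc ?tud // (lt_trans ad).
- subst d; exists c; split; last exact: ltn_trans ltd.
  by move=> a ac; rewrite stc ?tud.
Qed.

HB.instance Definition _ := gen_eqMixin surreal.
HB.instance Definition _ := gen_choiceMixin surreal.
HB.instance Definition _ := Order.Lt_isPOrder.Build (Order.Disp tt tt) surreal
  surreal_lt_irr surreal_lt_trans.

Lemma surreal_ltP (s t : surreal) :
  reflect (exists c : ord, (forall a, a < c -> s a = t a) /\
                           (sign_rank (s c) < sign_rank (t c))%N) (s < t).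
Proof. exact: asboolP. Qed.

Lemma surreal_le_total : total (<=%O : rel surreal).
Proof.
move=> s t; have [st|/existsNP st] := pselect (forall a, s a = t a).
  by rewrite (surreal_ext st) lexx.
have [c sc cmin] := ord_least st.
have eqc a : a < c -> s a = t a by move=> /cmin /contrapT.
case: (ltngtP (sign_rank (s c)) (sign_rank (t c))) => [lt|gt|/sign_rank_inj//].
  by apply/orP; left; apply/ltW/surreal_ltP; exists c.
by apply/orP; right; apply/ltW/surreal_ltP; exists c; split=> // a /eqc.
Qed.

HB.instance Definition _ :=
  Order.POrder_isTotal.Build _ surreal surreal_le_total.

Lemma restr_subproof (s : surreal) (c a : ord) :
  (if a < c then s a else None) <> None <-> a < Order.min (len s) c.
Proof.
rewrite lt_min; case: (a < c); last by rewrite andbF.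
by rewrite andbT; apply: sgnP.
Qed.

Definition restr (s : surreal) (c : ord) : surreal :=
  Surreal (restr_subproof s c).

Definition restr_le (s : surreal) (c : ord) : surreal := restr s (ord_succ c).

Lemma snoc_plus_subproof (u : surreal) (a : ord) :
  (if a == len u then Some Plus else u a) <> None <-> a < ord_succ (len u).
Proof.
rewrite ord_lt_succ le_eqVlt; case: (a == len u) => //=.
exact: sgnP.
Qed.

Definition snoc_plus (u : surreal) : surreal :=
  Surreal (snoc_plus_subproof u).

Definition is_max (S : set surreal) (u : surreal) : Prop := S u /\ ubound S u.

(* [stable_at S c u]: [u] is a witness that [sup^* S] is defined at [c] *)
Definition stable_at (S : set surreal) (c : ord) (u : surreal) : Prop :=
  [/\ S u, u c <> None &
      forall u', S u' -> u <= u' -> restr_le u' c = restr_le u c].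

Definition supstar_sgn (S : set surreal) (c : ord) : option sign :=
  if pselect (exists u, stable_at S c u) is left h
  then sval (cid h) c else None.

Lemma restr_leE (s : surreal) (a c : ord) : a <= c -> restr_le s c a = s a.
Proof. by move=> ac /=; rewrite ord_lt_succ ac. Qed.

Lemma supstar_sgnE (S : set surreal) (c : ord) (u : surreal) :
  stable_at S c u -> supstar_sgn S c = u c.
Proof.
rewrite /supstar_sgn => uP; case: pselect => [h|[]]; last by exists u.
case: (cid h) => v /= [Sv vc vP]; case: uP => Su uc uP.
rewrite -(restr_leE v (lexx c)) -(restr_leE u (lexx c)).
by case: (leP u v) => [uv|/ltW vu]; [rewrite uP|rewrite vP].
Qed.

Lemma supstar_sgn_def (S : set surreal) (c : ord) :
  supstar_sgn S c <> None <-> exists u, stable_at S c u.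
Proof.
split; last by move=> [u uP]; rewrite (supstar_sgnE uP); case: uP.
by rewrite /supstar_sgn; case: pselect.
Qed.

Lemma supstar_sgn_len (S : set surreal) :
  is_small S ->
  exists l : ord, forall c, supstar_sgn S c <> None <-> c < l.
Proof.
move=> Ssmall; have [b bP] : exists b, forall u, S u -> len u < b.
  have [I [f SE]] := Ssmall.
  have [|b bP] := @ord_small_ub (range (len \o f)); first by exists I, (len \o f).
  by exists b => u; rewrite SE => -[i _ <-]; apply: bP; exists i.
have [|l ln lmin] := @ord_least [set c | ~ exists u, stable_at S c u].
  exists b => -[u [/bP ub /sgnP bu _]].
  by have := lt_trans ub bu; rewrite ltxx.
exists l => c; rewrite supstar_sgn_def; split; last by move=> /lmin /contrapT.
move=> [u [Su uc uP]]; rewrite ltNge; apply/negP => lc; apply: ln.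
exists u; split=> //.
  by apply/sgnP; apply: le_lt_trans lc _; apply/sgnP.
move=> u' Su' uu'; have E := uP u' Su' uu'; apply: surreal_ext => a /=.
rewrite ord_lt_succ; case: (leP a l) => // al.
by rewrite -(restr_leE u' (le_trans al lc)) E restr_leE // (le_trans al lc).
Qed.

Definition supstar (S : set surreal) (Ssmall : is_small S) : surreal :=
  if pselect (exists u, is_max S u) is left h then snoc_plus (sval (cid h))
  else Surreal (svalP (cid (supstar_sgn_len Ssmall))).

Lemma supstar_max (S : set surreal) (Ssmall : is_small S) (u : surreal) :
  is_max S u -> supstar Ssmall = snoc_plus u.
Proof.
rewrite /supstar => -[Su uM]; case: pselect => [h|[]]; last by exists u.
case: (cid h) => v /= [Sv vM]; congr snoc_plus.
by apply/eqP; rewrite eq_le uM // vM.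
Qed.

Lemma supstar_nomax (S : set surreal) (Ssmall : is_small S) :
  ~ (exists u, is_max S u) ->
  forall c, (supstar Ssmall c <> None <-> exists u, stable_at S c u) /\
            (forall u, stable_at S c u -> supstar Ssmall c = u c).
Proof.
rewrite /supstar; case: pselect => // h _ c; split.
  exact: supstar_sgn_def.
exact: supstar_sgnE.
Qed.

(* Main.v *)
Require Import Defs.
From mathcomp Require Import all_boot all_order.
From mathcomp Require Import boolp classical_sets.
Local Open Scope order_scope.

(** If [S] has a maximum [u], then [u < z] says exactly that [z] first exceeds
    [u] at some position [<= len u], i.e. that [snoc_plus u] is at most [z] cut
    at [len u + 1]. If [S] has no maximum, each initial segment of [s = sup^* S]
    is shared by a tail of [S]; hence [u] cut at [alpha = len s] is at most [s]
    for all [u] in [S]. Equality is impossible: all larger members of [S] would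
    extend [s], so their nondecreasing signs at [alpha] would stabilise, either
    at a defined value, making [s] defined at [alpha], or at undefined, giving
    [S] the maximum [s]. Thus [u < s] already below [alpha], which gives one
    implication; conversely, if [z] drops below [s] at [c < alpha], it drops
    below the witness that [s] is stable at [c]. *)

Import Order.TTheory.

Lemma sgn_lenN (s : surreal) (a : ord) : len s <= a -> s a = None.
Proof.
move=> sa; apply: contrapT => /sgnP.
by rewrite ltNge sa.
Qed.

Lemma sgn_restr (s : surreal) (a c : ord) : c < a -> restr s a c = s c.
Proof. by move=> /= ->. Qed.

Lemma restr_lt (s t : surreal) (a : ord) : restr s a < restr t a -> s < t.
Proof.
move=> /surreal_ltP[c [eqc /=]]; case: ltP => // ca ltc.
apply/surreal_ltP; exists c; split=> // b bc.
by have := eqc b bc; rewrite !sgn_restr // (lt_trans bc ca).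
Qed.

Lemma restr_homo (a : ord) (s t : surreal) :
  s <= t -> restr s a <= restr t a.
Proof.
by move=> st; rewrite leNgt; apply/negP => /restr_lt; rewrite ltNge st.
Qed.

Lemma restr_id (s : surreal) (a : ord) : len s <= a -> restr s a = s.
Proof.
move=> sa; apply: surreal_ext => c /=; case: ltP => // ac.
by rewrite sgn_lenN // (le_trans sa).
Qed.

Lemma le_sign_rank (s t : surreal) (a : ord) :
  (forall b, b < a -> s b = t b) -> s <= t ->
  (sign_rank (s a) <= sign_rank (t a))%N.
Proof.
move=> eqa; rewrite leqNgt; apply: contraTN => lta; rewrite -ltNge.
by apply/surreal_ltP; exists a; split=> // b /eqa.
Qed.

Lemma snoc_plus_le (u z : surreal) :
  u < z <-> snoc_plus u <= restr z (len (snoc_plus u)).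
Proof.
split.
  move=> /surreal_ltP[c [eqc ltc]].
  (* If [len u < c], agreement below [c] makes [z] undefined at [len u] too, so both are undefined
     at [c] and cannot differ there. *)
  have cu : c <= len u.
    rewrite leNgt; apply/negP => uc; move: ltc.
    rewrite (sgn_lenN u) ?(ltW uc) // (sgn_lenN z) //.
    apply: le_trans (ltW uc); rewrite leNgt; apply/negP => /sgnP.
    by rewrite -eqc // sgn_lenN.
  move: cu; rewrite le_eqVlt => /orP[/eqP cE|cu].
    (* Exceeding [u] at [len u] means that [z] has a plus there, so the cut of [z] is [snoc_plus u]
       itself. *)
    rewrite le_eqVlt; apply/orP; left; apply/eqP/surreal_ext => a /=.
    rewrite ord_lt_succ; case: ltgtP => [au|ua|->].
    - by rewrite eqc // cE.
    - by rewrite sgn_lenN // ltW.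
    - move: ltc; rewrite cE (sgn_lenN u) //.
      by case: (z (len u)) => [[]|].
  apply/ltW/surreal_ltP; exists c; split=> [a ac|] /=.
    have au := lt_trans ac cu.
    by rewrite ord_lt_succ (ltW au) (lt_eqF au) eqc.
  by rewrite ord_lt_succ (ltW cu) (lt_eqF cu).
rewrite le_eqVlt => /orP[/eqP E|/surreal_ltP[c [eqc ltc]]].
  have Ea a : snoc_plus u a = restr z (len (snoc_plus u)) a by rewrite -E.
  apply/surreal_ltP; exists (len u); split=> [a au|].
    by have := Ea a; rewrite /= ord_lt_succ (ltW au) (lt_eqF au).
  have := Ea (len u); rewrite /= ord_lt_succ lexx eqxx => <-.
  by rewrite sgn_lenN.
move: ltc; rewrite /= ord_lt_succ; case: (ltgtP c (len u)) => [cu ltc|uc|_].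
- apply/surreal_ltP; exists c; split=> // a ac; have au := lt_trans ac cu.
  by have := eqc a ac; rewrite /= ord_lt_succ (ltW au) (lt_eqF au).
- by rewrite sgn_lenN // ltW.
- by case: (z c) => [[]|].
Qed.

Lemma stable_at_le {S : set surreal} {a c : ord} {u : surreal} :
  a <= c -> stable_at S c u -> stable_at S a u.
Proof.
move=> ac [Su /sgnP uc uP]; split=> //.
  by apply/sgnP; apply: le_lt_trans uc.
move=> v Sv uv; apply: surreal_ext => b /=; rewrite ord_lt_succ.
case: leP => // ba; have bc := le_trans ba ac.
by rewrite -(restr_leE v bc) uP // restr_leE.
Qed.

Section NoMax.
Context {S : set surreal} (Ssmall : is_small S).
Context (nomax : ~ exists u, is_max S u).
Let s := supstar Ssmall.

Lemma supstar_stable {a c : ord} {u : surreal} :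
  stable_at S c u -> a <= c -> s a = u a.
Proof.
move=> uP ac; have [_] := supstar_nomax Ssmall nomax a.
by apply; apply: stable_at_le uP.
Qed.

Lemma supstar_witness {c : ord} : c < len s -> exists u, stable_at S c u.
Proof. by move=> /sgnP; have [[]] := supstar_nomax Ssmall nomax c. Qed.

(** If the cut of [u] first exceeded [s] at [c], a witness [w] for [c] would satisfy [w < u];
    stability then gives [u] the sign of [w], hence of [s], at [c]. *)
Lemma restr_le_supstar (u : surreal) : S u -> restr u (len s) <= s.
Proof.
move=> Su; rewrite leNgt; apply/negP => /surreal_ltP[c [eqc /=]].
case: ltP => cs; last by rewrite sgn_lenN.
have [w wP] := supstar_witness cs; have ws a := @supstar_stable a _ _ wP.
rewrite ws // => ltc; have [_ _ /(_ u Su) wu] := wP.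
have : w < u.
  apply/surreal_ltP; exists c; split=> // a ac.
  by rewrite -ws ?(ltW ac) // eqc // sgn_restr // (lt_trans ac).
move=> /ltW /wu E; move: ltc.
by rewrite -(restr_leE u (lexx c)) E restr_leE // ltnn.
Qed.

Lemma restr_neq_supstar (u : surreal) : S u -> restr u (len s) <> s.
Proof.
move=> Su uE; set P := fun v => S v /\ u <= v.
(* Cutting is monotone, so the cut of [v] is squeezed between the cut of [u], which is [s], and
   [s]. *)
have PE v : P v -> restr v (len s) = s.
  move=> [Sv uv]; apply/eqP; rewrite eq_le restr_le_supstar //=.
  by rewrite -{1}uE restr_homo.
have Peq v w a : P v -> P w -> a < len s -> v a = w a.
  by move=> Pv Pw al; rewrite -(sgn_restr v _ _ al) -(sgn_restr w _ _ al) !PE.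
have [v Pv vmax] : exists2 v, P v & forall w, P w -> v <= w ->
    w (len s) = v (len s).
  have Pu : P u by [].
  (* Ranks at [len s] never decrease along [P] and are at most 2, so each change of sign lowers this
     difference. *)
  have [n] := ubnP (2 - sign_rank (u (len s))).
  move: (u) Pu => v; elim: n v => // n IH v Pv vn.
  have [vP|/existsNP[w /not_implyP[Pw /not_implyP[vw wv]]]] := pselect
    (forall w, P w -> v <= w -> w (len s) = v (len s)); first by exists v.
  apply: (IH w Pw).
  have := le_sign_rank _ _ _ (fun b => Peq v w b Pv Pw) vw.
  rewrite leq_eqVlt => /orP[/eqP/sign_rank_inj E|]; first by case: wv.
  move=> lt; rewrite ltnS in vn; apply: leq_trans vn; apply: ltn_sub2l => //.
  by apply: leq_trans lt _; case: (w _) => [[]|].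
have Pup w : S w -> v <= w -> P w.
  by move=> Sw vw; split=> //; apply: le_trans Pv.2 vw.
case: (pselect (v (len s) = None)) => [vN|vD].
  (* Members above [v] are undefined at [len s] as well, so they and [v] all equal their cut [s]. *)
  apply: nomax; exists v; split=> [|w Sw]; first exact: Pv.1.
  case/orP: (le_total w v) => // vw; have Pw := Pup w Sw vw.
  have lenP (x : surreal) : x (len s) = None -> len x <= len s.
    by move=> xN; rewrite leNgt; apply/negP => /sgnP.
  rewrite -(restr_id w (len s)); last by apply: lenP; rewrite vmax.
  by rewrite -(restr_id v (len s)) ?lenP // !PE.
have vS : stable_at S (len s) v.
  split=> [||w Sw vw]; [exact: Pv.1|exact: vD|].
  have Pw := Pup w Sw vw; apply: surreal_ext => a /=.
  rewrite ord_lt_succ; case: ltgtP => // [al|->]; first exact: Peq.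
  exact: vmax.
by apply: vD; rewrite -(supstar_stable vS) // sgn_lenN.
Qed.

End NoMax.

Theorem theorem4p3 (S : set surreal) (Ssmall : is_small S) (z : surreal) :
  (forall u : surreal, S u -> u < z) <->
  supstar Ssmall <= restr z (len (supstar Ssmall)).
Proof.
have [[m mM]|nomax] := pselect (exists u, is_max S u).
  rewrite (supstar_max Ssmall mM) -snoc_plus_le; have [Sm ubm] := mM.
  split=> [|mz u Su]; first exact.
  by apply: le_lt_trans mz; apply: ubm.
split=> [Sz|sz u Su].
  rewrite leNgt; apply/negP => /surreal_ltP[c [eqc /=]].
  case: ltP => cs; last by rewrite sgn_lenN.
  have [w wP] := supstar_witness Ssmall nomax cs.
  have ws a := @supstar_stable _ Ssmall nomax a _ _ wP.
  rewrite ws // => ltc; have [Sw _ _] := wP.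
  have : z < w.
    apply/surreal_ltP; exists c; split=> // a ac.
    by rewrite -ws ?(ltW ac) // -eqc // sgn_restr // (lt_trans ac).
  by rewrite ltNge (ltW (Sz w Sw)).
(* A strict inequality between the cuts lifts to [u < z]. *)
apply: (restr_lt u z (len (supstar Ssmall))); apply: lt_le_trans sz.
rewrite lt_neqAle restr_le_supstar // andbT.
exact/eqP/restr_neq_supstar.
Qed.
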